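(* Let $\mathcal{C}$ be a $\mathbf{DCPO}$-$\dagger$-category. Every functional (continuous function) $\varphi:\mathcal{C}(X,Y)\to\mathcal{C}(X,Y)$, where $X,Y$ are objects of $\mathcal{C}$, is fixed point adjoint to its conjugate $\overline{\varphi}:\mathcal{C}(Y,X)\to\mathcal{C}(Y,X)$; that is, $(\mathrm{fix}\,\varphi)^\dagger=\mathrm{fix}\,\overline{\varphi}$.
   Context: $\mathbf{DCPO}$ is the category of pointed directed complete partial orders (posets with a least element $\bot$ in which every non-empty directed subset has a supremum) and continuous maps (maps preserving suprema of directed sets; they need not preserve $\bot$). A $\mathbf{DCPO}$-category is a category $\mathcal{C}$ in which each homset $\mathcal{C}(X,Y)$ is a pointed directed complete partial order (order $\sqsubseteq$, least element $\bot_{X,Y}$), and composition is continuous and strict (i.e. $\bot\circ f=\bot$ and $g\circ\bot=\bot$). A dagger category is a category $\mathcal{C}$ with a functor $(-)^\dagger:\mathcal{C}^{\mathrm{op}}\to\mathcal{C}$ that is the identity on objects, so $f:X\to Y$ gives $f^\dagger:Y\to X$, with $\mathrm{id}_X^\dagger=\mathrm{id}_X$, $(g\circ f)^\dagger=f^\dagger\circ g^\dagger$ and $f^{\dagger\dagger}=f$. A $\mathbf{DCPO}$-$\dagger$-category is a $\mathbf{DCPO}$-category that is also a dagger category and whose dagger is locally monotone: $f\sqsubseteq g$ implies $f^\dagger\sqsubseteq g^\dagger$ for all parallel $f,g$. For a continuous $\varphi:\mathcal{C}(X,Y)\to\mathcal{C}(X,Y)$, $\mathrm{fix}\,\varphi:X\to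 Y$ denotes its least fixed point, given by $\sup_{n\in\omega}\varphi^n(\bot_{X,Y})$. The conjugate of $\varphi$ is $\overline{\varphi}:\mathcal{C}(Y,X)\to\mathcal{C}(Y,X)$, $\overline{\varphi}(g)=\varphi(g^\dagger)^\dagger$. A functional $\varphi_\ddagger:\mathcal{C}(Y,X)\to\mathcal{C}(Y,X)$ is fixed point adjoint to $\varphi:\mathcal{C}(X,Y)\to\mathcal{C}(X,Y)$ iff $(\mathrm{fix}\,\varphi)^\dagger=\mathrm{fix}\,\varphi_\ddagger$; this relation is symmetric. *)

(* Defs.v *)
From HB Require Import structures.
From mathcomp Require Import all_boot all_order.
From mathcomp Require Import boolp classical_sets.

Set Implicit Arguments.
Unset Strict Implicit.
Unset Printing Implicit Defensive.

Import Order.TTheory.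
Local Open Scope classical_set_scope.
Local Open Scope order_scope.

Definition directed d (T : porderType d) (D : set T) : Prop :=
  D !=set0 /\
  forall x y, D x -> D y -> exists z, [/\ D z, x <= z & y <= z].

HB.mixin Record hasDirectedSups d T of Order.BPOrder d T := {
  directed_sup_ex : forall D : set T, directed D -> exists s, isLub D s
}.

(* The order relation is bool-valued and T is a choiceType, but under the
   axioms of boolp every pointed dcpo can be equipped in this way. *)
#[short(type="dcpoType")]
HB.structure Definition Dcpo d :=
  {T of Order.BPOrder d T & hasDirectedSups d T}.

(* Monotonicity follows, by considering D = {x, y} with x <= y
   (see scott_continuous_homo).  The least element need not be preserved. *)
Definition scott_continuous d d' (T : porderType d) (U : porderType d')
    (f : T -> U) : Prop :=
  forall (D : set T) (s : T), directed D -> isLub D s -> isLub (f @` D) (f s).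

Record scott_map d d' (T : dcpoType d) (U : dcpoType d') := ScottMap {
  scott_fun :> T -> U;
  scott_funP : scott_continuous scott_fun
}.

(* The supremum exists (fixp_isLub), so the default value of supremum is never
   used; it is the least fixed point of phi (fixp_fixed, fixp_least). *)
Definition fixp d (T : dcpoType d) (phi : scott_map T T) : T :=
  supremum \bot (range (fun n => iter n phi \bot)).

(* comp g f is "g after f".  Continuity of composition is joint continuity, the
   source being the product of the two homsets with the componentwise order. *)
Record dcpoCategory (d : Order.disp_t) := DcpoCategory {
  obj :> Type;
  hom : obj -> obj -> dcpoType d;
  idm : forall X, hom X X;
  comp : forall X Y Z, hom Y Z -> hom X Y -> hom X Z;
  comp_idl : forall X Y (f : hom X Y), comp (idm Y) f = f;
  comp_idr : forall X Y (f : hom X Y), comp f (idm X) = f;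
  compA : forall X Y Z W (h : hom Z W) (g : hom Y Z) (f : hom X Y),
    comp h (comp g f) = comp (comp h g) f;
  comp_continuous : forall X Y Z,
    scott_continuous (fun p : hom Y Z *p hom X Y => comp p.1 p.2);
  comp_botl : forall X Y Z (f : hom X Y), comp (\bot : hom Y Z) f = \bot;
  comp_botr : forall X Y Z (g : hom Y Z), comp g (\bot : hom X Y) = \bot
}.

Record dcpoDaggerCategory (d : Order.disp_t) := DcpoDaggerCategory {
  dcpo_cat :> dcpoCategory d;
  dagger : forall X Y : dcpo_cat, hom X Y -> hom Y X;
  dagger_id : forall X : dcpo_cat, dagger (idm X) = idm X;
  dagger_comp : forall (X Y Z : dcpo_cat) (g : hom Y Z) (f : hom X Y),
    dagger (comp g f) = comp (dagger f) (dagger g);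
  daggerK : forall (X Y : dcpo_cat) (f : hom X Y), dagger (dagger f) = f;
  dagger_homo : forall (X Y : dcpo_cat) (f g : hom X Y),
    f <= g -> dagger f <= dagger g
}.

Definition functional d (C : dcpoCategory d) (X Y : C) :=
  scott_map (hom X Y) (hom X Y).

Definition fixpoint_adjoint d (C : dcpoDaggerCategory d) (X Y : C)
    (phi : functional X Y) (psi : functional Y X) : Prop :=
  dagger (fixp phi) = fixp psi.

Section ScottTheory.
Context d (T : porderType d) d' (U : porderType d').

Lemma scott_continuous_homo (f : T -> U) :
  scott_continuous f -> {homo f : x y / x <= y}.
Proof.
move=> cf x y xy.
have dD : directed [set x; y].
  split; first by exists x; left.
  move=> a b Da Db; exists y; split; first by right.
    by case: Da => ->.
  by case: Db => ->.
have lD : isLub [set x; y] y.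
  by split=> [a [] -> //|b]; apply; right.
by have [ub _] := cf _ _ dD lD; apply: ub; exists x => //; left.
Qed.

Lemma directed_image (f : T -> U) (D : set T) :
  {homo f : x y / x <= y} -> directed D -> directed (f @` D).
Proof.
move=> hf [[x0 Dx0] dD]; split; first by exists (f x0), x0.
move=> _ _ [x Dx <-] [y Dy <-]; have [z [Dz xz yz]] := dD _ _ Dx Dy.
by exists (f z); split; [exists z|exact: hf|exact: hf].
Qed.

End ScottTheory.

Section FixTheory.
Context d (T : dcpoType d) (phi : scott_map T T).

Lemma iter_bot_homo :
  {homo (fun n => iter n phi \bot) : m n / (m <= n)%N >-> m <= n}.
Proof.
apply: homo_leq => [x //|y x z|n]; first exact: le_trans.
elim: n => [|n IHn]; first exact: le0x.
exact: (scott_continuous_homo (scott_funP phi)).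
Qed.

Lemma iter_bot_directed : directed (range (fun n => iter n phi \bot)).
Proof.
split; first by exists \bot, 0%N.
move=> _ _ [m _ <-] [n _ <-]; exists (iter (maxn m n) phi \bot).
by split; [exists (maxn m n)|apply: iter_bot_homo; exact: leq_maxl
  |apply: iter_bot_homo; exact: leq_maxr].
Qed.

Lemma fixp_isLub : isLub (range (fun n => iter n phi \bot)) (fixp phi).
Proof.
have [s ls] := directed_sup_ex _ iter_bot_directed.
rewrite /fixp /supremum; case: eqP => [e|_].
  by have [[x]] := iter_bot_directed; rewrite e.
by case: xgetP => [x -> //|/(_ s)].
Qed.

Lemma fixp_fixed : phi (fixp phi) = fixp phi.
Proof.
have [ub1 lb1] := scott_funP phi iter_bot_directed fixp_isLub.
have [ub lb] := fixp_isLub.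
apply/le_anti/andP; split.
  by apply: lb1 => _ [_ [n _ <-] <-]; apply: ub; exists n.+1.
apply: lb => _ [[|n] _ <-]; first exact: le0x.
by apply: ub1; exists (iter n phi \bot) => //; exists n.
Qed.

Lemma fixp_least x : phi x = x -> fixp phi <= x.
Proof.
move=> phix; have [_] := fixp_isLub; apply => _ [n _ <-].
elim: n => [|n IHn]; first exact: le0x.
by rewrite -phix; apply: (scott_continuous_homo (scott_funP phi)).
Qed.

End FixTheory.

Section Conjugate.
Context d (C : dcpoDaggerCategory d).

Lemma dagger_continuous (X Y : C) : scott_continuous (@dagger d C X Y).
Proof.
move=> D s _ [ub lb]; split=> [_ [x Dx <-]|b ubb].
  by apply/dagger_homo/ub.
rewrite -[b]daggerK; apply/dagger_homo/lb => x Dx.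
by rewrite -[x]daggerK; apply/dagger_homo/ubb; exists x.
Qed.

Context (X Y : C) (phi : functional X Y).

Lemma conjugate_continuous :
  scott_continuous (fun g : hom Y X => dagger (phi (dagger g))).
Proof.
move=> D s dD lD.
rewrite (_ : (_ @` D) = @dagger _ _ _ _ @` (phi @` (@dagger _ _ _ _ @` D))).
  have dD1 := directed_image (@dagger_homo _ C _ _) dD.
  have hphi := scott_continuous_homo (scott_funP phi).
  have dD2 := directed_image hphi dD1.
  by apply/(dagger_continuous dD2)/(scott_funP phi dD1)/dagger_continuous.
by rewrite !image_comp.
Qed.

Definition conjugate : functional Y X := ScottMap conjugate_continuous.

End Conjugate.

(* Main.v *)
Require Import Defs.
From mathcomp Require Import all_boot all_order.

(** The dagger is a monotone involution, hence an isomorphism of posets from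
    [hom X Y] to [hom Y X], and it intertwines [phi] with its conjugate.  So it
    restricts to an order isomorphism between their sets of fixed points, and
    must carry the least one to the least one.  Since [conjugate phi] is [phi]
    transported along the dagger, each of the two inequalities follows from
    leastness of one of the fixed points ([fixp_least]), applied to the dagger
    of the other; no supremum has to be computed. *)

Theorem theorem2 (d : Order.disp_t) (C : dcpoDaggerCategory d) (X Y : C)
    (phi : functional X Y) :
  fixpoint_adjoint phi (conjugate phi).
Proof.
apply/Order.POrderTheory.le_anti/andP; split.
- (* Move the dagger across the inequality to use leastness of [fixp phi]. *)
  rewrite -[X in (_ <= X)%O]daggerK; apply: dagger_homo; apply: fixp_least.
  by rewrite -[phi _]daggerK -[in RHS]fixp_fixed.
- by apply: fixp_least; rewrite /= daggerK fixp_fixed.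
Qed.
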